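(* Let $\boldsymbol p=(p_j)_{j\ge1}$ and $\boldsymbol q=(q_j)_{j\ge1}$ be probability mass functions on $\{1,2,\dots\}$ with finite means. If $\boldsymbol p\preccurlyeq_{\mathrm{st}}\boldsymbol q$, then $\rho_{\mathrm{CM}}(\boldsymbol p)\le\rho_{\mathrm{CM}}(\boldsymbol q)$.
   Context: $\boldsymbol p\preccurlyeq_{\mathrm{st}}\boldsymbol q$ means $\sum_{j\ge K}p_j\le\sum_{j\ge K}q_j$ for all $K\ge 1$. $\rho_{\mathrm{CM}}(\boldsymbol p)$ is the limiting proportion of vertices in the giant component of the configuration model with limiting degree distribution $\boldsymbol p$: letting $D\sim\boldsymbol p$, $g_D(s)=\sum_{j\ge1}p_js^j$ and $\nu=\mathbb{E}[D(D-1)]/\mathbb{E}[D]\in[0,\infty]$, one sets $\rho_{\mathrm{CM}}(\boldsymbol p)=1-g_D(\eta)$, where $\eta$ is the smallest solution in $[0,1]$ of $g_D'(\eta)=\mathbb{E}[D]\eta$ if $\nu>1$ (so $\eta=0$ if $p_1=0$), and $\eta=1$ if $\nu\le1$. *)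

(* Defs.v *)
From Stdlib Require Import Reals Lra Lia Classical ClassicalEpsilon.
From Coquelicot Require Import Coquelicot.

Open Scope R_scope.

(* A mass function on {1,2,...} is a sequence on nat with [p 0 = 0], so that it
   is directly the coefficient sequence of its generating function. *)
Definition is_pmf (p : nat -> R) : Prop :=
  (forall j, 0 <= p j) /\ p 0%nat = 0 /\ is_series p 1.

Definition finite_mean (p : nat -> R) : Prop :=
  ex_series (fun j => INR j * p j).

Definition mean (p : nat -> R) : R := Series (fun j => INR j * p j).

Definition st_le (p q : nat -> R) : Prop :=
  forall K : nat, (1 <= K)%nat ->
    Series (fun j => p (K + j)%nat) <= Series (fun j => q (K + j)%nat).

Definition pgf (p : nat -> R) (s : R) : R := PSeries p s.

(* Termwise derivative rather than [Derive (pgf p)]: at s = 1 the two-sided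
   derivative need not make sense, and g_D'(1) is the derivative from the left;
   see [is_derive_pgf] and [left_derive_pgf]. *)
Definition pgf' (p : nat -> R) (s : R) : R := PSeries (PS_derive p) s.

(* The partial sums are taken in [Rbar], as E[D(D-1)] may be infinite. *)
Definition factorial_moment2 (p : nat -> R) : Rbar :=
  Lim_seq (sum_n (fun j => INR j * (INR j - 1) * p j)).

Definition nu (p : nat -> R) : Rbar :=
  Rbar_div (factorial_moment2 p) (Finite (mean p)).

Definition eta_solution (p : nat -> R) (s : R) : Prop :=
  0 <= s <= 1 /\ pgf' p s = mean p * s.

Definition smallest_eta_solution (p : nat -> R) (s : R) : Prop :=
  eta_solution p s /\ forall t, eta_solution p t -> s <= t.

Definition eta (p : nat -> R) : R :=
  if Rbar_lt_dec (Finite 1) (nu p)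
  then epsilon (inhabits 1) (smallest_eta_solution p)
  else 1.

Definition rho_CM (p : nat -> R) : R := 1 - pgf p (eta p).

Lemma CV_radius_ge1 (p : nat -> R) :
  is_pmf p -> Rbar_le (Finite 1) (CV_radius p).
Proof.
  intros [H0 [_ H1]].
  apply (proj1 (CV_radius_bounded p)).
  assert (B : is_lim_seq p 0) by (apply ex_series_lim_0; now exists 1).
  destruct (filterlim_bounded p (ex_intro _ 0 B)) as [M HM].
  exists M. intros n. rewrite pow1, Rmult_1_r. apply (HM n).
Qed.

Lemma is_derive_pgf (p : nat -> R) (s : R) :
  is_pmf p -> Rabs s < 1 -> is_derive (pgf p) s (pgf' p s).
Proof.
  intros Hp Hs. apply is_derive_PSeries.
  apply Rbar_lt_le_trans with (Finite 1); [exact Hs | now apply CV_radius_ge1].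
Qed.

Lemma ex_pseries_derive1 (p : nat -> R) :
  finite_mean p -> ex_pseries (PS_derive p) 1.
Proof.
  intros Hm. apply (ex_series_incr_1 (fun j => INR j * p j)) in Hm.
  refine (ex_series_ext _ _ _ Hm). intros n. unfold PS_derive.
  rewrite pow_n_pow, pow1. symmetry. apply Rmult_1_l.
Qed.

Lemma pgf'_1 (p : nat -> R) : finite_mean p -> pgf' p 1 = mean p.
Proof.
  intros Hm. unfold pgf', PSeries, mean. rewrite (Series_incr_1 _ Hm).
  change (INR 0) with 0. rewrite Rmult_0_l, Rplus_0_l. apply Series_ext. intros n.
  unfold PS_derive. rewrite pow1. ring.
Qed.

Lemma left_derive_pgf (p : nat -> R) :
  is_pmf p -> finite_mean p ->
  filterlim (fun s => (pgf p s - pgf p 1) / (s - 1)) (at_left 1)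
    (locally (pgf' p 1)).
Proof.
  intros Hp Hm.
  assert (C : forall a, Rbar_le (Finite 1) (CV_radius a) -> ex_pseries a 1 ->
            filterlim (PSeries a) (at_left 1) (locally (PSeries a 1))).
  { intros a Ha Hx. destruct (Rbar_le_lt_or_eq_dec _ _ Ha) as [h|h].
    - apply (filterlim_filter_le_1 (F := locally 1) (G := at_left 1)).
      + apply filter_le_within.
      + apply continuity_pt_filterlim, PSeries_continuity.
        now rewrite Rabs_R1.
    - pose proof (Abel a) as A. rewrite <- h in A. apply A; simpl; auto. lra. }
  assert (C0 : filterlim (pgf p) (at_left 1) (locally (pgf p 1))).
  { apply C. now apply CV_radius_ge1. exists 1. destruct Hp as (_ & _ & H).
    refine (is_series_ext _ _ _ _ H). intros n. rewrite pow_n_pow, pow1.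
    symmetry. apply Rmult_1_l. }
  assert (C1 : filterlim (pgf' p) (at_left 1) (locally (pgf' p 1))).
  { apply C. rewrite CV_radius_derive. now apply CV_radius_ge1.
    now apply ex_pseries_derive1. }
  apply filterlim_locally. intros eps.
  assert (He2 : 0 < eps / 2) by (destruct eps as [e He]; simpl; lra).
  destruct (proj1 (filterlim_locally _ _) C1 (mkposreal _ He2)) as [d Hd].
  assert (Hd1 : 0 < Rmin d 1) by (apply Rmin_pos; [apply cond_pos | lra]).
  exists (mkposreal _ Hd1). intros s Hs Hs1.
  assert (Hs2 : 1 - Rmin d 1 < s).
  { change (Rabs (s - 1) < Rmin d 1) in Hs. apply Rabs_def2 in Hs. lra. }
  pose proof (Rmin_l d 1). pose proof (Rmin_r d 1).
  set (m := pgf' p 1) in *.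
  assert (D : forall t, s < t < 1 ->
            Rabs (pgf p s - pgf p t - m * (s - t)) <= eps / 2 * (1 - s)).
  { intros t Ht.
    destruct (MVT_gen (pgf p) s t (pgf' p)) as [c [Hc E]].
    - rewrite Rmin_left, Rmax_right by lra. intros x Hx.
      apply is_derive_pgf; auto. apply Rabs_def1; lra.
    - rewrite Rmin_left, Rmax_right by lra. intros x Hx.
      apply continuity_pt_filterlim.
      apply (@ex_derive_continuous _ _ (pgf p)). exists (pgf' p x).
      apply is_derive_pgf; auto. apply Rabs_def1; lra.
    - rewrite Rmin_left, Rmax_right in Hc by lra.
      assert (Hcm : Rabs (pgf' p c - m) < eps / 2).
      { apply (Hd c); [|lra]. change (Rabs (c - 1) < d). apply Rabs_def1; lra. }
      replace (pgf p s - pgf p t - m * (s - t))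
        with ((pgf' p c - m) * (s - t)) by lra.
      rewrite Rabs_mult, (Rabs_left (s - t)) by lra.
      apply Rmult_le_compat; try apply Rabs_pos; lra. }
  assert (L : Rabs (pgf p s - pgf p 1 - m * (s - 1)) <= eps / 2 * (1 - s)).
  { apply Rnot_lt_le. intros N.
    set (k := Rabs (pgf p s - pgf p 1 - m * (s - 1)) - eps / 2 * (1 - s)).
    assert (K : 0 < k / 2) by (unfold k; lra).
    assert (F : filterlim (fun t => pgf p s - pgf p t - m * (s - t))
                (at_left 1) (locally (pgf p s - pgf p 1 - m * (s - 1)))).
    { assert (I : filterlim (fun t => pgf p s - m * (s - t)) (at_left 1)
                  (locally (pgf p s - m * (s - 1)))).
      { apply (filterlim_filter_le_1 (F := locally 1) (G := at_left 1)).
        apply filter_le_within.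
        apply (ex_derive_continuous (fun t => pgf p s - m * (s - t))).
        auto_derive; auto. }
      replace (pgf p s - pgf p 1 - m * (s - 1))
        with (plus (opp (pgf p 1)) (pgf p s - m * (s - 1)))
        by (unfold plus, opp; simpl; ring).
      apply filterlim_ext with
        (fun t => plus (opp (pgf p t)) (pgf p s - m * (s - t))).
      { intros t. unfold plus, opp; simpl; ring. }
      apply (filterlim_comp_2 (fun t => opp (pgf p t)) _ plus
               (filterlim_comp _ _ _ _ _ _ _ _ C0 (filterlim_opp _)) I).
      exact (@filterlim_plus _ R_NormedModule (opp (pgf p 1)) _). }
    destruct (proj1 (filterlim_locally _ _) F (mkposreal _ K)) as [d' Hd'].
    set (t := Rmax ((1 + s) / 2) (1 - d' / 2)).
    pose proof (cond_pos d').
    assert (T : s < t < 1).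
    { unfold t. split. apply Rlt_le_trans with (2 := Rmax_l _ _); lra.
      apply Rmax_lub_lt; lra. }
    assert (T2 : Rabs (t - 1) < d').
    { pose proof (Rmax_r ((1 + s) / 2) (1 - d' / 2)). fold t in H2.
      apply Rabs_def1; lra. }
    specialize (Hd' t T2 (proj2 T)). specialize (D t T).
    change (Rabs ((pgf p s - pgf p t - m * (s - t))
                  - (pgf p s - pgf p 1 - m * (s - 1))) < k / 2) in Hd'.
    rewrite Rabs_minus_sym in Hd'.
    pose proof (Rabs_triang_inv (pgf p s - pgf p 1 - m * (s - 1))
                 (pgf p s - pgf p t - m * (s - t))).
    unfold k in *; lra. }
  change (Rabs ((pgf p s - pgf p 1) / (s - 1) - m) < eps).
  replace ((pgf p s - pgf p 1) / (s - 1) - m)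
    with ((pgf p s - pgf p 1 - m * (s - 1)) / (s - 1)) by (field; lra).
  unfold Rdiv at 1. rewrite Rabs_mult, Rabs_inv, (Rabs_left (s - 1)) by lra.
  apply Rle_lt_trans with (eps / 2); [|lra].
  apply (Rmult_le_reg_r (- (s - 1))); [lra|].
  rewrite Rmult_assoc, Rinv_l by lra. lra.
Qed.

Lemma smallest_eta_solution_exists (p : nat -> R) :
  is_pmf p -> finite_mean p -> exists s, smallest_eta_solution p s.
Proof.
  intros Hp Hm.
  assert (S1 : eta_solution p 1).
  { split; [lra|]. rewrite pgf'_1 by assumption. ring. }
  destruct (completeness (fun x => eta_solution p (- x))) as [l [Hub Hl]].
  { exists 0. intros x [Hx _]. lra. }
  { exists (- 1). now replace (- - 1) with 1 by ring. }
  assert (Hl1 : -1 <= l) by (apply Hub; now replace (- - 1) with 1 by ring).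
  assert (Hl0 : l <= 0) by (apply Hl; intros x [Hx _]; lra).
  exists (- l). split.
  2:{ intros t Ht. enough (- t <= l) by lra.
      apply Hub. now rewrite Ropp_involutive. }
  destruct (Req_dec l (-1)) as [->|Hn]; [now replace (- - 1) with 1 by ring|].
  split; [lra|]. apply NNPP. intros N.
  assert (Cf : continuity_pt (fun s => pgf' p s - mean p * s) (- l)).
  { apply continuity_pt_minus.
    - apply PSeries_continuity. rewrite CV_radius_derive.
      apply Rbar_lt_le_trans with (Finite 1); [|now apply CV_radius_ge1].
      apply Rabs_def1; lra.
    - apply continuity_pt_filterlim.
      apply (ex_derive_continuous (fun t => mean p * t)). auto_derive; auto. }
  set (f := fun s => pgf' p s - mean p * s) in *.
  assert (Hf : 0 < Rabs (f (- l))) by (apply Rabs_pos_lt; unfold f; lra).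
  apply continuity_pt_filterlim in Cf.
  destruct (proj1 (filterlim_locally _ _) Cf (mkposreal _ Hf)) as [d Hd].
  pose proof (cond_pos d).
  enough (l <= l - d / 2) by lra.
  apply Hl. intros x Hx. apply Rnot_lt_le. intros Hx2.
  pose proof (Hub x Hx).
  assert (B : Rabs (- x - - l) < d) by (apply Rabs_def1; lra).
  specialize (Hd (- x) B). change (Rabs (f (- x) - f (- l)) < Rabs (f (- l))) in Hd.
  destruct Hx as [_ Hx]. replace (f (- x)) with 0 in Hd by (unfold f; lra).
  rewrite Rminus_0_l, Rabs_Ropp in Hd. lra.
Qed.

Lemma eta_spec (p : nat -> R) :
  is_pmf p -> finite_mean p -> Rbar_lt (Finite 1) (nu p) ->
  smallest_eta_solution p (eta p).
Proof.
  intros Hp Hm Hn. unfold eta. destruct (Rbar_lt_dec (Finite 1) (nu p)).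
  - now apply epsilon_spec, smallest_eta_solution_exists.
  - contradiction.
Qed.

(* Main.v *)
Require Import Defs.
From Stdlib Require Import Reals Lra Lia Ranalysis5.
From Coquelicot Require Import Coquelicot.

Open Scope R_scope.

(** The size-biased laws of [p] and [q] need not be ordered, but the fixed-point
    equation can be rewritten so that only expectations of monotone functions
    of the degree occur.

    Put [h_p(s) = g_p'(s) - E[D] s = E[D (s^(D-1) - s)]].  For fixed [s] in
    [[0,1]] the function [j (s^(j-1) - s)] is nonincreasing in [j >= 1], so
    [p <=st q] gives [h_q <= h_p] on [[0,1]].  Hence [h_q <= 0] at
    [eta p], while [h_q(0) = q_1 >= 0]; by continuity [h_q] vanishes somewhere
    in [[0, eta p]], and so [eta q <= eta p] ([smallest_solution_antitone]).
    Since [g_q] is nondecreasing in [s] and [s^j] is nonincreasing in [j],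
    [g_q(eta q) <= g_q(eta p) <= g_p(eta p)], which is the claim.

    This treats [eta p] and [eta q] as smallest solutions, so both laws have to
    be supercritical.  If [p] is not, then [eta p = 1] and [eta q <= eta p] is
    clear.  If [p] is, so is [q]: [nu <= 1] means [E[D(D-2)] <= 0], and
    [j (j-2)] is nondecreasing in [j >= 1] ([nu_le_1_antitone]).

    All three comparisons are instances of [st_le_expectation], which is
    summation by parts against the tails. *)

(** * Expectations of monotone functions *)

Lemma Series_nonneg (a : nat -> R) :
  (forall n, 0 <= a n) -> ex_series a -> 0 <= Series a.
Proof.
  intros Ha He. rewrite <- (Rmult_0_l (Series a)), <- Series_scal_l.
  apply Series_le; auto. intros n. specialize (Ha n). lra.
Qed.

Definition tail (p : nat -> R) (K : nat) : R := Series (fun j => p (K + j)%nat).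

Lemma ex_series_pmf (p : nat -> R) : is_pmf p -> ex_series p.
Proof. intros (_ & _ & H). now exists 1. Qed.

Lemma tail_nonneg (p : nat -> R) (K : nat) : is_pmf p -> 0 <= tail p K.
Proof.
  intros Hp. apply Series_nonneg.
  - intros n. apply Hp.
  - apply -> (ex_series_incr_n p). now apply ex_series_pmf.
Qed.

Lemma tail_step (p : nat -> R) (K : nat) :
  is_pmf p -> tail p K = p K + tail p (S K).
Proof.
  intros Hp. unfold tail. rewrite Series_incr_1.
  - rewrite Nat.add_0_r. f_equal. apply Series_ext. intros n. f_equal. lia.
  - apply -> (ex_series_incr_n p). now apply ex_series_pmf.
Qed.

Lemma tail_1 (p : nat -> R) : is_pmf p -> tail p 1 = 1.
Proof.
  intros Hp. pose proof (tail_step p 0 Hp) as E.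
  replace (tail p 0) with 1 in E.
  - destruct Hp as (_ & H0 & _). lra.
  - destruct Hp as (_ & _ & H). symmetry. exact (is_series_unique _ _ H).
Qed.

(** The expectation of [f (min D N)]. *)
Definition capped_expectation (f p : nat -> R) (N : nat) : R :=
  sum_n (fun j => f j * p j) N + f N * tail p (S N).

Lemma capped_expectation_step (f p : nat -> R) (N : nat) :
  is_pmf p ->
  capped_expectation f p (S N)
  = capped_expectation f p N + (f (S N) - f N) * tail p (S N).
Proof.
  intros Hp. unfold capped_expectation. rewrite sum_Sn.
  rewrite (tail_step p (S N) Hp). unfold plus; simpl. ring.
Qed.

(** Summation by parts writes both sides as sums of the increments of [f] with
    the tails as weights.  Monotonicity from [1] on suffices: the first
    increment, [f 1 - f 0], has the weight [tail _ 1 = 1] on both sides. *)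
Lemma capped_expectation_le (f p q : nat -> R) (N : nat) :
  is_pmf p -> is_pmf q -> st_le p q ->
  (forall n, (1 <= n)%nat -> f n <= f (S n)) ->
  capped_expectation f p N <= capped_expectation f q N.
Proof.
  intros Hp Hq Hpq Hf. induction N as [|N IH].
  - unfold capped_expectation. rewrite !sum_O, !tail_1 by assumption.
    destruct Hp as (_ & -> & _). destruct Hq as (_ & -> & _). lra.
  - rewrite !capped_expectation_step by assumption.
    destruct N as [|N].
    + rewrite !tail_1 by assumption. lra.
    + apply Rplus_le_compat; [exact IH|]. apply Rmult_le_compat_l.
      * assert (f (S N) <= f (S (S N))) by (apply Hf; lia). lra.
      * apply Hpq. lia.
Qed.

Lemma monotone_from_1 (f : nat -> R) :
  (forall n, (1 <= n)%nat -> f n <= f (S n)) ->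
  forall m k, (1 <= m)%nat -> f m <= f (m + k)%nat.
Proof.
  intros Hf m k Hm. induction k as [|k IH].
  - rewrite Nat.add_0_r. lra.
  - rewrite Nat.add_succ_r. apply Rle_trans with (1 := IH). apply Hf. lia.
Qed.

Lemma capped_expectation_le_Series (f q : nat -> R) (N : nat) :
  is_pmf q -> (1 <= N)%nat ->
  (forall n, (1 <= n)%nat -> f n <= f (S n)) ->
  ex_series (fun j => f j * q j) ->
  capped_expectation f q N <= Series (fun j => f j * q j).
Proof.
  intros Hq HN Hf He. unfold capped_expectation.
  rewrite (Series_incr_n (fun j => f j * q j) (S N)) by (try lia; assumption).
  rewrite <- sum_n_Reals. simpl pred. apply Rplus_le_compat_l.
  unfold tail. rewrite <- Series_scal_l.
  (* [Series_le] asks for a nonnegative lower series, so the difference of the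
     two series is compared with zero instead. *)
  assert (E1 : ex_series (fun j => f (S N + j)%nat * q (S N + j)%nat)).
  { now apply -> (ex_series_incr_n (fun j => f j * q j)). }
  assert (E2 : ex_series (fun j => f N * q (S N + j)%nat)).
  { apply (ex_series_scal (V := R_NormedModule) (f N)
             (fun j => q (S N + j)%nat)).
    apply -> (ex_series_incr_n q). now apply ex_series_pmf. }
  apply Rminus_le_0. rewrite <- Series_minus by assumption.
  apply Series_nonneg.
  - intros n.
    rewrite <- Rmult_minus_distr_r. apply Rmult_le_pos; [|apply Hq].
    pose proof (monotone_from_1 f Hf N (S n) HN) as M.
    replace (S N + n)%nat with (N + S n)%nat by lia. lra.
  - now apply (ex_series_minus (V := R_NormedModule)
             (fun j => f (S N + j)%nat * q (S N + j)%nat)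
             (fun j => f N * q (S N + j)%nat)).
Qed.

Lemma st_le_expectation_nonneg (f p q : nat -> R) :
  is_pmf p -> is_pmf q -> st_le p q ->
  (forall n, (1 <= n)%nat -> f n <= f (S n)) ->
  0 <= f 1%nat ->
  ex_series (fun j => f j * q j) ->
  ex_series (fun j => f j * p j) /\
  Series (fun j => f j * p j) <= Series (fun j => f j * q j).
Proof.
  intros Hp Hq Hpq Hf H1 He.
  assert (Pos : forall n, 0 <= f (S n)).
  { intros n. pose proof (monotone_from_1 f Hf 1 n (le_n 1)) as M. simpl in M. lra. }
  assert (Inc : forall n, sum_n (fun j => f j * p j) n
                          <= sum_n (fun j => f j * p j) (S n)).
  { intros n. rewrite sum_Sn. unfold plus; simpl.
    pose proof (Rmult_le_pos _ _ (Pos n) (proj1 Hp (S n))). lra. }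
  assert (Bnd : forall n, sum_n (fun j => f j * p j) n
                          <= Series (fun j => f j * q j)).
  { intros n. apply Rle_trans with (1 := Inc n).
    apply Rle_trans with (capped_expectation f p (S n)).
    - unfold capped_expectation.
      pose proof (Rmult_le_pos _ _ (Pos n) (tail_nonneg p (S (S n)) Hp)). lra.
    - apply Rle_trans with (capped_expectation f q (S n)).
      + now apply capped_expectation_le.
      + apply capped_expectation_le_Series; auto. lia. }
  destruct (ex_finite_lim_seq_incr _ _ Inc Bnd) as [l Hl].
  assert (S : is_series (fun j => f j * p j) l) by exact Hl.
  split; [now exists l|].
  rewrite (is_series_unique _ _ S).
  exact (is_lim_seq_le _ _ (Finite l) (Finite (Series (fun j => f j * q j)))
           Bnd Hl (is_lim_seq_const _)).
Qed.

(** Summability against the smaller law comes for free: on [j >= 1] the function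
    [f] is bounded below by [f 1]. *)
Lemma st_le_expectation (f p q : nat -> R) :
  is_pmf p -> is_pmf q -> st_le p q ->
  (forall n, (1 <= n)%nat -> f n <= f (S n)) ->
  ex_series (fun j => f j * q j) ->
  ex_series (fun j => f j * p j) /\
  Series (fun j => f j * p j) <= Series (fun j => f j * q j).
Proof.
  intros Hp Hq Hpq Hf He.
  set (c := f 1%nat).
  assert (Ec : forall r, is_pmf r -> ex_series (fun j => c * r j)).
  { intros r Hr. apply (ex_series_scal (V := R_NormedModule) c r).
    now apply ex_series_pmf. }
  assert (Sc : forall r, is_pmf r -> Series (fun j => c * r j) = c).
  { intros r (_ & _ & Hr). rewrite Series_scal_l, (is_series_unique _ _ Hr). ring. }
  assert (Eq : ex_series (fun j => (f j - c) * q j)).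
  { apply (ex_series_ext (fun j => f j * q j - c * q j)).
    - intros n. symmetry. apply Rmult_minus_distr_r.
    - now apply (ex_series_minus (V := R_NormedModule)
        (fun j => f j * q j) (fun j => c * q j)); [|apply Ec]. }
  destruct (st_le_expectation_nonneg (fun j => f j - c) p q) as [Ep Le]; auto.
  { intros n Hn. specialize (Hf n Hn). lra. }
  { unfold c. lra. }
  assert (Back : forall r, is_pmf r -> ex_series (fun j => (f j - c) * r j) ->
      is_series (fun j => f j * r j) (Series (fun j => (f j - c) * r j) + c)).
  { intros r Hr Er.
    apply (is_series_ext (fun j => (f j - c) * r j + c * r j)).
    - intros n. simpl. ring.
    - apply (is_series_plus (V := R_NormedModule)).
      + now apply Series_correct.
      + rewrite <- (Sc r Hr) at 1. now apply Series_correct, Ec. }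
  split; [eexists; now apply Back|].
  rewrite (is_series_unique _ _ (Back p Hp Ep)).
  rewrite (is_series_unique _ _ (Back q Hq Eq)). lra.
Qed.

(** * Generating functions *)

Lemma pow_le_1 (s : R) (n : nat) : 0 <= s <= 1 -> 0 <= s ^ n <= 1.
Proof.
  intros Hs. split; [now apply pow_le|].
  rewrite <- (pow1 n). now apply pow_incr.
Qed.

Lemma pow_decr_exp (s : R) (n : nat) : 0 <= s <= 1 -> s ^ S n <= s ^ n.
Proof.
  intros Hs. pose proof (pow_le_1 s n Hs). simpl.
  pose proof (Rmult_le_compat_r (s ^ n) s 1). lra.
Qed.

Lemma ex_series_pgf (p : nat -> R) (s : R) :
  is_pmf p -> 0 <= s <= 1 -> ex_series (fun j => p j * s ^ j).
Proof.
  intros Hp Hs.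
  apply (ex_series_le (V := R_CompleteNormedModule) _ p).
  - intros n. change (Rabs (p n * s ^ n) <= p n).
    pose proof (pow_le_1 s n Hs). pose proof (proj1 Hp n).
    rewrite Rabs_pos_eq by (apply Rmult_le_pos; lra).
    pose proof (Rmult_le_compat_l (p n) (s ^ n) 1). lra.
  - now apply ex_series_pmf.
Qed.

Lemma pgf_incr (p : nat -> R) (s t : R) :
  is_pmf p -> 0 <= s <= t -> t <= 1 -> pgf p s <= pgf p t.
Proof.
  intros Hp Hs Ht. unfold pgf, PSeries. apply Series_le.
  - intros n. pose proof (proj1 Hp n). split.
    + apply Rmult_le_pos; auto. apply pow_le; lra.
    + apply Rmult_le_compat_l; auto. now apply pow_incr.
  - apply ex_series_pgf; auto. lra.
Qed.

Lemma pgf_st_antitone (p q : nat -> R) (s : R) :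
  is_pmf p -> is_pmf q -> st_le p q -> 0 <= s <= 1 -> pgf q s <= pgf p s.
Proof.
  intros Hp Hq Hpq Hs.
  assert (Opp : forall r, Series (fun j => - s ^ j * r j) = - pgf r s).
  { intros r. unfold pgf, PSeries. rewrite <- Series_opp.
    apply Series_ext. intros n. ring. }
  destruct (st_le_expectation (fun j => - s ^ j) p q) as [_ Le]; auto.
  - intros n _. pose proof (pow_decr_exp s n Hs). lra.
  - apply (ex_series_ext (fun j => - (q j * s ^ j))).
    + intros n. simpl. ring.
    + apply (ex_series_opp (V := R_NormedModule)). now apply ex_series_pgf.
  - rewrite !Opp in Le. lra.
Qed.

(** The sign is chosen so that the summed function is nondecreasing in the
    degree, as [st_le_expectation] requires. *)
Lemma is_series_eta_equation (p : nat -> R) (s : R) :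
  is_pmf p -> finite_mean p -> 0 <= s <= 1 ->
  is_series (fun j => (INR j * s - INR j * s ^ pred j) * p j)
    (mean p * s - pgf' p s).
Proof.
  intros Hp Hm Hs.
  assert (M : is_series (fun j => INR j * p j * s) (mean p * s)).
  { apply (is_series_ext (fun j => s * (INR j * p j))).
    - intros n. simpl. ring.
    - rewrite Rmult_comm.
      apply (is_series_scal (V := R_NormedModule) s).
      now apply Series_correct. }
  assert (Ed : ex_series (fun j => INR j * p j * s ^ pred j)).
  { apply (ex_series_le (V := R_CompleteNormedModule) _ (fun j => INR j * p j)).
    - intros n. change (Rabs (INR n * p n * s ^ pred n) <= INR n * p n).
      pose proof (pow_le_1 s (pred n) Hs).
      pose proof (Rmult_le_pos _ _ (pos_INR n) (proj1 Hp n)) as P.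
      rewrite Rabs_pos_eq by (apply Rmult_le_pos; lra).
      pose proof (Rmult_le_compat_l _ (s ^ pred n) 1 P). lra.
    - exact Hm. }
  assert (D : is_series (fun j => INR j * p j * s ^ pred j) (pgf' p s)).
  { replace (pgf' p s) with (Series (fun j => INR j * p j * s ^ pred j)).
    - now apply Series_correct.
    - rewrite (Series_incr_1 _ Ed). simpl INR at 1. rewrite !Rmult_0_l, Rplus_0_l.
      reflexivity. }
  apply (is_series_ext (fun j => INR j * p j * s - INR j * p j * s ^ pred j)).
  - intros n. simpl. ring.
  - now apply (is_series_minus (V := R_NormedModule)
      (fun j => INR j * p j * s) (fun j => INR j * p j * s ^ pred j)).
Qed.

(** The increment of [j (s - s^(j-1))] from [n] to [n+1] is
    [(s - s^n) + n (s^(n-1) - s^n)], a sum of nonnegative terms for [n >= 1]. *)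
Lemma eta_equation_st_antitone (p q : nat -> R) (s : R) :
  is_pmf p -> is_pmf q -> finite_mean p -> finite_mean q -> st_le p q ->
  0 <= s <= 1 ->
  pgf' q s - mean q * s <= pgf' p s - mean p * s.
Proof.
  intros Hp Hq Hmp Hmq Hpq Hs.
  pose proof (is_series_eta_equation p s Hp Hmp Hs) as Sp.
  pose proof (is_series_eta_equation q s Hq Hmq Hs) as Sq.
  destruct (st_le_expectation
    (fun j => INR j * s - INR j * s ^ pred j) p q) as [_ Le]; auto.
  - intros [|n] Hn; [lia|]. change (pred (S n)) with n.
    change (pred (S (S n))) with (S n). rewrite (S_INR (S n)).
    pose proof (pow_decr_exp s n Hs) as P.
    pose proof (pow_le_1 s n Hs) as Q.
    assert (T : s ^ S n <= s).
    { simpl. pose proof (Rmult_le_compat_l s (s ^ n) 1). lra. }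
    pose proof (Rmult_le_compat_l _ _ _ (pos_INR (S n)) P). lra.
  - eexists. exact Sq.
  - rewrite (is_series_unique _ _ Sp), (is_series_unique _ _ Sq) in Le. lra.
Qed.

Lemma pgf'_0 (p : nat -> R) : pgf' p 0 = p 1%nat.
Proof. unfold pgf'. rewrite PSeries_0. unfold PS_derive. simpl. ring. Qed.

Lemma eta_equation_continuous (p : nat -> R) (s : R) :
  is_pmf p -> 0 <= s < 1 ->
  continuity_pt (fun t => mean p * t - pgf' p t) s.
Proof.
  intros Hp Hs. apply continuity_pt_minus.
  - apply continuity_pt_filterlim.
    apply (ex_derive_continuous (fun t => mean p * t)). auto_derive; auto.
  - apply PSeries_continuity. rewrite CV_radius_derive.
    apply Rbar_lt_le_trans with (Finite 1); [|now apply CV_radius_ge1].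
    apply Rabs_def1; lra.
Qed.

Lemma smallest_solution_antitone (p q : nat -> R) (s t : R) :
  is_pmf p -> is_pmf q -> finite_mean p -> finite_mean q -> st_le p q ->
  smallest_eta_solution p s -> smallest_eta_solution q t -> t <= s.
Proof.
  intros Hp Hq Hmp Hmq Hpq [[Hs Es] _] [[Ht _] Min].
  destruct (Req_dec s 1) as [->|Hs1]; [lra|].
  pose proof (eta_equation_st_antitone p q s Hp Hq Hmp Hmq Hpq Hs) as H.
  pose proof (proj1 Hq 1%nat) as H1. pose proof (pgf'_0 q) as H0.
  (* [IVT_interv] wants strict signs at both ends of a nondegenerate interval:
     where [g_q' - mean q * id] vanishes at an end, that end is a solution. *)
  destruct (Req_dec (pgf' q s) (mean q * s)) as [E|N].
  { now apply Min. }
  destruct (Req_dec (q 1%nat) 0) as [E|N1].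
  { apply Rle_trans with 0; [|lra]. apply Min. split; lra. }
  assert (S0 : 0 < s).
  { destruct (Req_dec s 0) as [->|]; lra. }
  destruct (IVT_interv (fun t => mean q * t - pgf' q t) 0 s) as [z [Hz Ez]].
  - intros a Ha. apply eta_equation_continuous; auto. lra.
  - exact S0.
  - lra.
  - lra.
  - apply Rle_trans with z; [|lra]. apply Min. split; lra.
Qed.

(** * Criticality *)

Lemma mean_pos (p : nat -> R) : is_pmf p -> finite_mean p -> 0 < mean p.
Proof.
  intros Hp Hm. enough (1 <= mean p) by lra.
  rewrite <- (is_series_unique _ _ (proj2 (proj2 Hp))).
  unfold mean. apply Series_le; auto.
  intros [|n]; pose proof (proj1 Hp) as H.
  - destruct Hp as (_ & -> & _). lra.
  - split; [apply H|]. rewrite S_INR. pose proof (pos_INR n).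
    specialize (H (S n)).
    pose proof (Rmult_le_pos _ _ H0 H). lra.
Qed.

Lemma factorial_moment2_term_nonneg (p : nat -> R) (n : nat) :
  is_pmf p -> 0 <= INR n * (INR n - 1) * p n.
Proof.
  intros Hp. apply Rmult_le_pos; [|apply Hp].
  destruct n as [|n]; [simpl; lra|]. rewrite S_INR.
  pose proof (pos_INR n). apply Rmult_le_pos; lra.
Qed.

(** The condition [nu <= 1] compares [E[D(D-1)]] with [E[D]]; as the mean is
    finite, it amounts to [E[D(D-2)] <= 0], where [D(D-2)], unlike the ratio
    defining [nu], respects the stochastic order. *)
Lemma nu_le_1_iff (p : nat -> R) :
  is_pmf p -> finite_mean p ->
  (Rbar_le (nu p) (Finite 1) <->
   ex_series (fun j => INR j * (INR j - 2) * p j) /\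
   Series (fun j => INR j * (INR j - 2) * p j) <= 0).
Proof.
  intros Hp Hm. pose proof (mean_pos p Hp Hm) as Mp.
  pose proof (Rinv_0_lt_compat _ Mp) as Mi.
  set (u := sum_n (fun j => INR j * (INR j - 1) * p j)).
  split.
  - intros Hn.
    assert (L : ex_lim_seq u).
    { apply ex_lim_seq_incr. intros n. unfold u. rewrite sum_Sn.
      unfold plus; simpl plus.
      pose proof (factorial_moment2_term_nonneg p (S n) Hp) as T.
      change (sum_n (fun j => INR j * (INR j - 1) * p j) n
        <= sum_n (fun j => INR j * (INR j - 1) * p j) n
           + INR (S n) * (INR (S n) - 1) * p (S n)). lra. }
    assert (Pos : Rbar_le (Finite 0) (Lim_seq u)).
    { rewrite <- (Lim_seq_const 0). apply Lim_seq_le_loc. exists 0%nat.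
      intros n _. unfold u. rewrite sum_n_Reals. apply cond_pos_sum.
      intros k. now apply factorial_moment2_term_nonneg. }
    apply Lim_seq_correct in L.
    unfold nu, factorial_moment2 in Hn. fold u in Hn.
    destruct (Lim_seq u) as [l| |].
    + simpl in Hn.
      assert (S2 : is_series (fun j => INR j * (INR j - 1) * p j) l) by exact L.
      assert (Hl : l <= mean p).
      { apply (Rmult_le_compat_r (mean p)) in Hn; [|lra].
        rewrite Rmult_assoc, Rinv_l in Hn; lra. }
      assert (S3 : is_series (fun j => INR j * (INR j - 2) * p j) (l - mean p)).
      { apply (is_series_ext
          (fun j => INR j * (INR j - 1) * p j - INR j * p j)).
        - intros n. simpl. ring.
        - apply (is_series_minus (V := R_NormedModule)); auto.
          now apply Series_correct. }
      split; [eexists; exact S3|].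
      rewrite (is_series_unique _ _ S3). lra.
    + exfalso. unfold Rbar_div in Hn. simpl Rbar_inv in Hn.
      rewrite (is_Rbar_mult_unique _ _ _
        (is_Rbar_mult_p_infty_pos (Finite (/ mean p)) Mi)) in Hn.
      exact Hn.
    + contradiction.
  - intros [E Le].
    assert (S1 : is_series (fun j => INR j * (INR j - 1) * p j)
              (Series (fun j => INR j * (INR j - 2) * p j) + mean p)).
    { apply (is_series_ext
        (fun j => INR j * (INR j - 2) * p j + INR j * p j)).
      - intros n. simpl. ring.
      - apply (is_series_plus (V := R_NormedModule)); now apply Series_correct. }
    unfold nu, factorial_moment2. fold u.
    assert (L : is_lim_seq u
       (Finite (Series (fun j => INR j * (INR j - 2) * p j) + mean p)))
      by exact S1.
    rewrite (is_lim_seq_unique _ _ L). simpl.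
    apply (Rmult_le_reg_r (mean p)); [lra|].
    rewrite Rmult_assoc, Rinv_l by lra. lra.
Qed.

Lemma nu_le_1_antitone (p q : nat -> R) :
  is_pmf p -> is_pmf q -> finite_mean p -> finite_mean q -> st_le p q ->
  Rbar_le (nu q) (Finite 1) -> Rbar_le (nu p) (Finite 1).
Proof.
  intros Hp Hq Hmp Hmq Hpq Hn.
  apply nu_le_1_iff in Hn as [Eq Lq]; auto. apply nu_le_1_iff; auto.
  destruct (st_le_expectation (fun j => INR j * (INR j - 2)) p q)
    as [Ep Le]; auto.
  - intros [|n] H; [lia|]. rewrite (S_INR (S n)), S_INR.
    pose proof (pos_INR n). lra.
  - split; [exact Ep | lra].
Qed.

Lemma eta_subcritical (p : nat -> R) :
  Rbar_le (nu p) (Finite 1) -> eta p = 1.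
Proof.
  intros H. unfold eta. destruct (Rbar_lt_dec (Finite 1) (nu p)) as [L|L]; auto.
  exfalso. now apply (Rbar_lt_not_le _ _ L).
Qed.

Lemma eta_bounds (p : nat -> R) :
  is_pmf p -> finite_mean p -> 0 <= eta p <= 1.
Proof.
  intros Hp Hm. destruct (Rbar_lt_dec (Finite 1) (nu p)) as [L|L].
  - now destruct (eta_spec p Hp Hm L) as [[H _] _].
  - rewrite eta_subcritical by now apply Rbar_not_lt_le. lra.
Qed.

(** * Monotonicity of the giant *)

Lemma eta_antitone (p q : nat -> R) :
  is_pmf p -> is_pmf q -> finite_mean p -> finite_mean q -> st_le p q ->
  eta q <= eta p.
Proof.
  intros Hp Hq Hmp Hmq Hpq.
  destruct (Rbar_lt_dec (Finite 1) (nu p)) as [Lp|Lp].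
  - assert (Lq : Rbar_lt (Finite 1) (nu q)).
    { apply Rbar_not_le_lt. intros N. apply (Rbar_lt_not_le _ _ Lp).
      now apply (nu_le_1_antitone p q). }
    apply (smallest_solution_antitone p q); auto using eta_spec.
  - rewrite (eta_subcritical p) by now apply Rbar_not_lt_le.
    now apply eta_bounds.
Qed.

Theorem theorem1p6 (p q : nat -> R)
  (hp : is_pmf p) (hq : is_pmf q)
  (hmp : finite_mean p) (hmq : finite_mean q)
  (hpq : st_le p q) :
  rho_CM p <= rho_CM q.
Proof.
  pose proof (eta_antitone p q hp hq hmp hmq hpq) as He.
  pose proof (eta_bounds p hp hmp) as Bp.
  pose proof (eta_bounds q hq hmq) as Bq.
  assert (H1 : pgf q (eta q) <= pgf q (eta p)) by (apply pgf_incr; auto; lra).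
  pose proof (pgf_st_antitone p q (eta p) hp hq hpq Bp) as H2.
  unfold rho_CM. lra.
Qed.
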